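(* Consider the 2D special relativistic hydrodynamics (RHD) system with a Synge-type equation of state $h=h(\theta)=1+e(\theta)+\theta$, $\theta=p/\rho$, satisfying $e'(\theta)>0$ and $h(\theta)>\theta(1+e'(\theta))/e'(\theta)$ for all $\theta>0$. Set $z_1=\rho$, $z_2=\rho/p$, $z_3=\gamma v_1$, $z_4=\gamma v_2$. Then $$\widetilde{\mathbf F}_1^{EC}(\mathbf U_L,\mathbf U_R)=\left(\{\!\{z_1\}\!\}_{\ln}\{\!\{z_3\}\!\},\ \widehat{\rho h}\{\!\{z_3\}\!\}^2+\frac{\{\!\{z_1\}\!\}}{\{\!\{z_2\}\!\}},\ \widehat{\rho h}\{\!\{z_3\}\!\}\{\!\{z_4\}\!\},\ \widehat{\rho h}\{\!\{\gamma\}\!\}\{\!\{z_3\}\!\}\right)^\top$$ and $$\widetilde{\mathbf F}_2^{EC}(\mathbf U_L,\mathbf U_R)=\left(\{\!\{z_1\}\!\}_{\ln}\{\!\{z_4\}\!\},\ \widehat{\rho h}\{\!\{z_3\}\!\}\{\!\{z_4\}\!\},\ \widehat{\rho h}\{\!\{z_4\}\!\}^2+\frac{\{\!\{z_1\}\!\}}{\{\!\{z_2\}\!\}},\ \widehat{\rho h}\{\!\{\gamma\}\!\}\{\!\{z_4\}\!\}\right)^\top$$ with $$\widehat{\rho h}:=\frac{\frac{\{\!\{z_1\}\!\}}{\{\!\{z_2\}\!\}}+\{\!\{z_1\}\!\}_{\ln}\mathcal E}{\{\!\{\gamma\}\!\}^2-\{\!\{z_3\}\!\}^2-\{\!\{z_4\}\!\}^2},\qquad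 \mathcal E:=\frac{[\![W_1]\!]-[\![\ln z_1]\!]}{[\![z_2]\!]}=1+\int_0^1e\!\left(\frac{1}{z_{2,L}+s(z_{2,R}-z_{2,L})}\right)ds,$$ are entropy conservative (EC) two-point numerical fluxes for this system in the $x_1$- and $x_2$-directions, respectively.
   Context: The 2D RHD system is $\partial_t\mathbf U+\partial_{x_1}\mathbf F_1(\mathbf U)+\partial_{x_2}\mathbf F_2(\mathbf U)=\mathbf 0$ with $\mathbf U=(D,m_1,m_2,E)^\top$, $\mathbf F_1=(Dv_1,\ v_1m_1+p,\ v_1m_2,\ m_1)^\top$, $\mathbf F_2=(Dv_2,\ v_2m_1,\ v_2m_2+p,\ m_2)^\top$, $D=\rho\gamma$, $m_k=\rho h\gamma^2v_k$, $E=\rho h\gamma^2-p$, where $\rho>0$, $p>0$, $v_1^2+v_2^2<1$, $\gamma=(1-v_1^2-v_2^2)^{-1/2}$, $\theta=p/\rho$; $e$ is continuously differentiable on $(0,\infty)$. With $S=-\ln\rho+\int^\theta\frac{e'(x)}{x}dx$ (a fixed antiderivative of $e'(\theta)/\theta$), the entropy variables (gradient with respect to $\mathbf U$ of the entropy $\eta=-DS$) are $\mathbf W=(W_1,W_2,W_3,W_4)^\top=\frac1\theta(h-\theta S,\gamma v_1,\gamma v_2,-\gamma)^\top$, and the entropy potential fluxes are $\psi_i=\rho\gamma v_i$, $i=1,2$. For states $\mathbf U_L,\mathbf U_R$, subscripts $L,R$ denote quantities evaluated at these states, and $[\![a]\!]=a_R-a_L$, $\{\!\{a\}\!\}=\frac12(a_L+a_R)$,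 $\{\!\{a\}\!\}_{\ln}=[\![a]\!]/[\![\ln a]\!]$ is the logarithmic mean (equal to $a_L$ if $a_L=a_R$). If $[\![z_2]\!]=0$, $\mathcal E$ is given by its integral formula. A two-point numerical flux $\widetilde{\mathbf F}_i(\mathbf U_L,\mathbf U_R)$ is EC if it is consistent, $\widetilde{\mathbf F}_i(\mathbf U,\mathbf U)=\mathbf F_i(\mathbf U)$, and satisfies $(\mathbf W_R-\mathbf W_L)^\top\widetilde{\mathbf F}_i(\mathbf U_L,\mathbf U_R)=\psi_{i,R}-\psi_{i,L}$ for all $\mathbf U_L,\mathbf U_R$. *)

(* Defs.v *)
From HB Require Import structures.
From mathcomp Require Import all_boot all_order all_algebra ring lra.
From mathcomp Require Import all_classical all_reals all_analysis.
Set Implicit Arguments.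
Unset Strict Implicit.
Unset Printing Implicit Defensive.
Import Order.TTheory GRing.Theory Num.Theory.
Import numFieldNormedType.Exports.
Local Open Scope classical_set_scope.
Local Open Scope ring_scope.

Definition vec4 (R : realType) (a b c d : R) : 'cV[R]_4 :=
  \col_(i < 4) [:: a; b; c; d]`_i.

Definition dot4 (R : realType) (x y : 'cV[R]_4) : R := (x^T *m y) 0 0.

Record prim (R : realType) := Prim
  { rho : R ; vel1 : R ; vel2 : R ; pres : R }.

HB.instance Definition _ (R : realType) := gen_eqMixin (prim R).
HB.instance Definition _ (R : realType) := gen_choiceMixin (prim R).

Definition physical (R : realType) (q : prim R) : Prop :=
  [/\ 0 < rho q, 0 < pres q & vel1 q ^+ 2 + vel2 q ^+ 2 < 1].

Definition lorentz (R : realType) (q : prim R) : R :=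
  (Num.sqrt (1 - vel1 q ^+ 2 - vel2 q ^+ 2))^-1.

Definition theta (R : realType) (q : prim R) : R := pres q / rho q.

Definition enthalpy (R : realType) (e : R -> R) (t : R) : R := 1 + e t + t.

(* The internal energy e is only constrained on ]0, +oo[; its values elsewhere
   are irrelevant. *)
Definition synge_eos (R : realType) (e : R -> R) : Prop :=
  forall t : R, 0 < t ->
    [/\ derivable e t 1, {for t, continuous (derive1 e)}, 0 < derive1 e t &
        t * (1 + derive1 e t) / derive1 e t < enthalpy e t].

(* A is a fixed antiderivative of e'(x)/x, used in the entropy S. *)
Definition entropy_antiderivative (R : realType) (e A : R -> R) : Prop :=
  forall t : R, 0 < t -> is_derive t (1 : R) A (derive1 e t / t).

Definition cons_of_prim (R : realType) (e : R -> R) (q : prim R) : 'cV[R]_4 :=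
  let H := rho q * enthalpy e (theta q) * lorentz q ^+ 2 in
  vec4 (rho q * lorentz q) (H * vel1 q) (H * vel2 q) (H - pres q).

Definition state_space (R : realType) (e : R -> R) : set 'cV[R]_4 :=
  cons_of_prim e @` [set q | physical q].

(* Primitive variables as functions of U; the default value is only used
   outside state_space e. They are uniquely determined by U for a Synge-type
   equation of state: see prim_of_consK below. *)
Definition prim_of_cons (R : realType) (e : R -> R) (U : 'cV[R]_4) : prim R :=
  xget (Prim 0 0 0 0) [set q | physical q /\ cons_of_prim e q = U].

Definition flux1 (R : realType) (e : R -> R) (U : 'cV[R]_4) : 'cV[R]_4 :=
  let q := prim_of_cons e U in
  let D := U 0 0 in let m1 := U 1 0 in let m2 := U 2%:R 0 in
  vec4 (D * vel1 q) (vel1 q * m1 + pres q) (vel1 q * m2) m1.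

Definition flux2 (R : realType) (e : R -> R) (U : 'cV[R]_4) : 'cV[R]_4 :=
  let q := prim_of_cons e U in
  let D := U 0 0 in let m1 := U 1 0 in let m2 := U 2%:R 0 in
  vec4 (D * vel2 q) (vel2 q * m1) (vel2 q * m2 + pres q) m2.

Definition entropyS (R : realType) (A : R -> R) (q : prim R) : R :=
  - ln (rho q) + A (theta q).

Definition entropy_var (R : realType) (e A : R -> R) (U : 'cV[R]_4) :
    'cV[R]_4 :=
  let q := prim_of_cons e U in
  (theta q)^-1 *:
    vec4 (enthalpy e (theta q) - theta q * entropyS A q)
         (lorentz q * vel1 q) (lorentz q * vel2 q) (- lorentz q).

Definition potential1 (R : realType) (e : R -> R) (U : 'cV[R]_4) : R :=
  let q := prim_of_cons e U in rho q * lorentz q * vel1 q.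

Definition potential2 (R : realType) (e : R -> R) (U : 'cV[R]_4) : R :=
  let q := prim_of_cons e U in rho q * lorentz q * vel2 q.

Definition entropy_conservative (R : realType) (e A : R -> R)
    (F : 'cV[R]_4 -> 'cV[R]_4) (psi : 'cV[R]_4 -> R)
    (Fnum : 'cV[R]_4 -> 'cV[R]_4 -> 'cV[R]_4) : Prop :=
  (forall U, state_space e U -> Fnum U U = F U) /\
  (forall UL UR, state_space e UL -> state_space e UR ->
     dot4 (entropy_var e A UR - entropy_var e A UL) (Fnum UL UR) =
     psi UR - psi UL).

Definition jump (R : realType) (aL aR : R) : R := aR - aL.

Definition avg (R : realType) (aL aR : R) : R := (aL + aR) / 2%:R.

Definition log_mean (R : realType) (aL aR : R) : R :=
  if aL == aR then aL else jump aL aR / jump (ln aL) (ln aR).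

Definition z1 (R : realType) (e : R -> R) (U : 'cV[R]_4) : R :=
  rho (prim_of_cons e U).
Definition z2 (R : realType) (e : R -> R) (U : 'cV[R]_4) : R :=
  rho (prim_of_cons e U) / pres (prim_of_cons e U).
Definition z3 (R : realType) (e : R -> R) (U : 'cV[R]_4) : R :=
  lorentz (prim_of_cons e U) * vel1 (prim_of_cons e U).
Definition z4 (R : realType) (e : R -> R) (U : 'cV[R]_4) : R :=
  lorentz (prim_of_cons e U) * vel2 (prim_of_cons e U).
Definition gam (R : realType) (e : R -> R) (U : 'cV[R]_4) : R :=
  lorentz (prim_of_cons e U).

Definition calE_quotient (R : realType) (e A : R -> R) (UL UR : 'cV[R]_4) : R :=
  (jump (entropy_var e A UL 0 0) (entropy_var e A UR 0 0)
   - jump (ln (z1 e UL)) (ln (z1 e UR))) / jump (z2 e UL) (z2 e UR).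

Definition calE_integral (R : realType) (e : R -> R) (UL UR : 'cV[R]_4) : R :=
  1 + \int[lebesgue_measure]_(s in `[0, 1])
        e (1 / (z2 e UL + s * (z2 e UR - z2 e UL))).

Definition calE (R : realType) (e A : R -> R) (UL UR : 'cV[R]_4) : R :=
  if jump (z2 e UL) (z2 e UR) == 0 then calE_integral e UL UR
  else calE_quotient e A UL UR.

Definition rhoh_hat (R : realType) (e A : R -> R) (UL UR : 'cV[R]_4) : R :=
  (avg (z1 e UL) (z1 e UR) / avg (z2 e UL) (z2 e UR)
   + log_mean (z1 e UL) (z1 e UR) * calE e A UL UR)
  / (avg (gam e UL) (gam e UR) ^+ 2
     - avg (z3 e UL) (z3 e UR) ^+ 2 - avg (z4 e UL) (z4 e UR) ^+ 2).

Definition flux1_EC (R : realType) (e A : R -> R) (UL UR : 'cV[R]_4) :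
    'cV[R]_4 :=
  let rh := rhoh_hat e A UL UR in
  let a3 := avg (z3 e UL) (z3 e UR) in
  let a4 := avg (z4 e UL) (z4 e UR) in
  vec4 (log_mean (z1 e UL) (z1 e UR) * a3)
       (rh * a3 ^+ 2 + avg (z1 e UL) (z1 e UR) / avg (z2 e UL) (z2 e UR))
       (rh * a3 * a4)
       (rh * avg (gam e UL) (gam e UR) * a3).

Definition flux2_EC (R : realType) (e A : R -> R) (UL UR : 'cV[R]_4) :
    'cV[R]_4 :=
  let rh := rhoh_hat e A UL UR in
  let a3 := avg (z3 e UL) (z3 e UR) in
  let a4 := avg (z4 e UL) (z4 e UR) in
  vec4 (log_mean (z1 e UL) (z1 e UR) * a4)
       (rh * a3 * a4)
       (rh * a4 ^+ 2 + avg (z1 e UL) (z1 e UR) / avg (z2 e UL) (z2 e UR))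
       (rh * avg (gam e UL) (gam e UR) * a4).

(* With M = m1^2 + m2^2 over D^2, one has (E/D)^2 = energy_sq e M theta. *)
Definition energy_sq (R : realType) (e : R -> R) (M t : R) : R :=
  (enthalpy e t ^+ 2 + M - t * enthalpy e t) ^+ 2 / (enthalpy e t ^+ 2 + M).

Lemma enthalpy_gt (R : realType) (e : R -> R) (t : R) :
  synge_eos e -> 0 < t -> t < enthalpy e t.
Proof.
move=> he t0; have [_ _ d0] := he _ t0; apply: lt_trans.
by rewrite ltr_pdivlMr// ltr_pM2l// ltrDr.
Qed.

Lemma energy_sq_lt (R : realType) (e : R -> R) (M s t : R) :
  synge_eos e -> 0 <= M -> 0 < s -> s < t -> energy_sq e M s < energy_sq e M t.
Proof.
move=> he M0 s0 st.
pose dh (x : R) : R := 1 + derive1 e x.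
pose h : R -> R := enthalpy e.
pose Q (x : R) : R := h x ^+ 2 + M.
pose N (x : R) : R := Q x - x * h x.
pose df (x : R) : R := 2 * N x * (h x * Q x * derive1 e x - x * dh x * M) / Q x ^+ 2.
have hgt (x : R) : 0 < x -> x < h x by move=> x0; apply: enthalpy_gt.
have Q0 (x : R) : 0 < x -> 0 < Q x.
  by move=> x0; rewrite ltr_wpDr// exprn_gt0// (lt_trans x0)// hgt.
have N0 (x : R) : 0 < x -> 0 < N x.
  move=> x0; rewrite /N /Q subr_gt0 ltr_wpDr// expr2 ltr_pM2r ?hgt//.
  by rewrite (lt_trans x0)// hgt.
have dH (x : R) : 0 < x -> is_derive x (1 : R) h (dh x).
  move=> x0; have [de _ _ _] := he _ x0.
  have de' : is_derive x (1 : R) e (derive1 e x).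
    by rewrite derive1E; apply/derivableP.
  have -> : h = cst 1 + e + id by apply/funext.
  by apply: is_derive_eq; rewrite /dh; ring.
have dF (x : R) : 0 < x -> is_derive x (1 : R) (energy_sq e M) (df x).
  move=> x0; have hx := dH _ x0.
  have dQ : is_derive x (1 : R) Q (2 * h x * dh x).
    have -> : Q = h ^+ 2 + cst M by apply/funext => y; rewrite /Q !fctE.
    by apply: is_derive_eq; rewrite /= /GRing.scale/=; ring.
  have dN : is_derive x (1 : R) N (2 * h x * dh x - h x - x * dh x).
    have -> : N = Q - id * h by apply/funext.
    by apply: is_derive_eq; rewrite /= /GRing.scale/=; ring.
  have dV : is_derive x (1 : R) (fun y => (Q y)^-1) (- (Q x) ^- 2 *: (2 * h x * dh x)).
    by apply: is_deriveV; rewrite // gt_eqF// Q0.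
  have -> : energy_sq e M = N ^+ 2 * (fun y => (Q y)^-1).
    by apply/funext => y; rewrite !fctE.
  apply: is_derive_eq; rewrite /= /GRing.scale/= /df !fctE.
  have Qn : Q x != 0 by rewrite gt_eqF// Q0.
  have -> : M = Q x - h x ^+ 2 by rewrite /Q; ring.
  by rewrite /N /dh; field.
have dfp (x : R) : 0 < x -> 0 < df x.
  move=> x0; have [_ _ e0 hx] := he _ x0.
  rewrite /df divr_gt0 ?exprn_gt0 ?Q0// mulr_gt0 ?mulr_gt0 ?N0// subr_gt0.
  move: hx; rewrite ltr_pdivrMr// -/(h x) -/(dh x) => hx.
  have dh0 : 0 < dh x by rewrite /dh addr_gt0.
  apply: (@le_lt_trans _ _ (x * dh x * Q x)).
    by rewrite ler_wpM2l ?mulr_ge0 ?(ltW x0) ?(ltW dh0)// lerDr sqr_ge0.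
  by rewrite [ltRHS]mulrAC ltr_pM2r ?Q0.
have [||c] := @MVT _ (energy_sq e M) df s t st.
- by move=> x /[!in_itv]/= /andP[sx _]; apply: dF; apply: lt_trans sx.
- apply: derivable_within_continuous => x /[!in_itv]/= /andP[sx _].
  by have [] := dF x (lt_le_trans s0 sx).
rewrite in_itv/= => /andP[sc _] E.
by rewrite -subr_gt0 E mulr_gt0 ?subr_gt0// dfp// (lt_trans s0).
Qed.

Lemma cons_of_prim_inj (R : realType) (e : R -> R) (q q' : prim R) :
  synge_eos e -> physical q -> physical q' ->
  cons_of_prim e q = cons_of_prim e q' -> q = q'.
Proof.
move=> he.
pose D (q : prim R) := rho q * lorentz q.
pose H (q : prim R) := rho q * enthalpy e (theta q) * lorentz q ^+ 2.
pose M (q : prim R) := ((H q * vel1 q) ^+ 2 + (H q * vel2 q) ^+ 2) / D q ^+ 2.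
have key (r : prim R) : physical r ->
  [/\ 0 < lorentz r, 0 < theta r, 0 < enthalpy e (theta r),
      lorentz r ^+ 2 = 1 + M r / enthalpy e (theta r) ^+ 2 &
      ((H r - pres r) / D r) ^+ 2 = energy_sq e (M r) (theta r)].
  case=> r0 p0 v1.
  have w0 : 0 < 1 - vel1 r ^+ 2 - vel2 r ^+ 2 by lra.
  have g0 : 0 < lorentz r by rewrite invr_gt0 sqrtr_gt0.
  have g2 : lorentz r ^+ 2 * (1 - vel1 r ^+ 2 - vel2 r ^+ 2) = 1.
    by rewrite exprVn sqr_sqrtr ?(ltW w0)// mulVf// gt_eqF.
  have t0 : 0 < theta r by rewrite divr_gt0.
  have h0 : 0 < enthalpy e (theta r) by rewrite (lt_trans t0)// enthalpy_gt.
  have hn := lt0r_neq0 h0; have gn := lt0r_neq0 g0; have rn := lt0r_neq0 r0.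
  have ME : M r = enthalpy e (theta r) ^+ 2 * (lorentz r ^+ 2 - 1).
    have -> : lorentz r ^+ 2 - 1 =
              lorentz r ^+ 2 * (vel1 r ^+ 2 + vel2 r ^+ 2) by rewrite -{1}g2; ring.
    by rewrite /M /D /H; field; rewrite rn gn.
  have pE : pres r = theta r * rho r by rewrite /theta divfK.
  split => //; first by rewrite ME; field.
  have QE : enthalpy e (theta r) ^+ 2 + M r =
            (enthalpy e (theta r) * lorentz r) ^+ 2 by rewrite ME; ring.
  by rewrite /energy_sq QE /H /D pE; field; rewrite ?rn ?gn ?hn.
move=> hq hq' /matrixP E.
have [r0 p0 _] := hq; have [r0' p0' _] := hq'.
have [g0 t0 h0 g2 f2] := key _ hq; have [g0' t0' h0' g2' f2'] := key _ hq'.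
have /= := E 0 0; rewrite !mxE/= -/(D q) -/(D q') => ED.
have /= := E 1 0; rewrite !mxE/= -/(H q) -/(H q') => E1.
have /= := E 2%:R 0; rewrite !mxE/= -/(H q) -/(H q') => E2.
have /= := E 3%:R 0; rewrite !mxE/= -/(H q) -/(H q') => E3.
have EM : M q = M q' by rewrite /M E1 E2 ED.
have M0 : 0 <= M q by rewrite divr_ge0 ?addr_ge0 ?sqr_ge0.
have Et : theta q = theta q'.
  have EE : energy_sq e (M q) (theta q) = energy_sq e (M q) (theta q').
    by rewrite -f2 E3 ED f2' EM.
  have [tt|tt|//] := ltgtP (theta q) (theta q').
  - by have := energy_sq_lt he M0 t0 tt; rewrite EE ltxx.
  - by have := energy_sq_lt he M0 t0' tt; rewrite EE ltxx.
have Eg : lorentz q = lorentz q'.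
  apply/eqP; rewrite -(@eqrXn2 _ 2) ?ltW//; apply/eqP.
  by rewrite g2 g2' Et EM.
have Er : rho q = rho q'.
  by apply: (mulIf (lt0r_neq0 g0)); rewrite {2}Eg.
have Ep : pres q = pres q'.
  by rewrite -(divfK (lt0r_neq0 r0) (pres q)) -/(theta q) Et Er /theta divfK// gt_eqF.
have EH : H q = H q' by rewrite /H Er Et Eg.
have H0 : H q' != 0 by rewrite /H !mulf_neq0// ?expf_neq0// gt_eqF.
move: E1 E2; rewrite EH => /(mulfI H0) E1 /(mulfI H0) E2.
by case: q q' Er Ep E1 E2 {hq hq' E r0 p0 r0' p0' g0 t0 h0 g2 f2 g0' t0' h0' g2' f2' ED E3 EM M0 Et Eg EH H0}
  => [? ? ? ?] [? ? ? ?] /= -> -> -> ->.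
Qed.

Lemma prim_of_consK (R : realType) (e : R -> R) (q : prim R) :
  synge_eos e -> physical q -> prim_of_cons e (cons_of_prim e q) = q.
Proof.
move=> he hq; apply: xget_unique => // r [hr E].
exact: cons_of_prim_inj he hr hq E.
Qed.

(* Main.v *)
Require Import Defs.
From mathcomp Require Import all_boot all_order all_algebra.
From mathcomp Require Import all_classical all_reals all_analysis.
From mathcomp Require Import ring lra.
Set Implicit Arguments.
Unset Strict Implicit.
Unset Printing Implicit Defensive.
Local Open Scope ring_scope.
Import Order.TTheory GRing.Theory Num.Theory.
Import numFieldNormedType.Exports.

(** Write every quantity in terms of z1, z2, z3, z4 and gamma.  Then
      W = (1 + z2 + phi(z2) + ln z1, z2 z3, z2 z4, - z2 gamma),
    where phi z = z e(1/z) - A(1/z) collects the part of W1 that depends on the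
    equation of state (lemma [entropy_varE]).  The choice A' = e'(x)/x in the
    entropy is what makes the terms with e' cancel in phi', so that
    phi' z = e(1/z) ([is_derive_energy_potential]).  By the fundamental theorem
    of calculus on the segment from z2,L to z2,R the quotient defining E equals
    its integral formula, and in all cases, equal z2 included,
      [[W1]] = [[ln z1]] + E [[z2]].

    What remains of the entropy condition is algebra ([ec_identity]).  The
    product rule for jumps, [[ab]] = {{a}}[[b]] + [[a]]{{b}}, expands [[W]].
    Since gamma^2 = 1 + z3^2 + z4^2, the jumps satisfy
    {{gamma}}[[gamma]] = {{z3}}[[z3]] + {{z4}}[[z4]], so the terms carrying
    rho h reduce to - [[z2]] ({{gamma}}^2 - {{z3}}^2 - {{z4}}^2) rho h {{z_k}}.
    The factor {{gamma}}^2 - {{z3}}^2 - {{z4}}^2 is nonzero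
    ([avg_lorentz_form_gt0]), and rho h is the solution of the linear equation
    saying that all multiples of [[z2]] cancel.  The remaining terms add up to
    {{z1}}[[z_k]] + [[z1]]{{z_k}} = [[z1 z_k]], the jump of the potential.

    Consistency follows from the integral formula at equal states, where
    E = 1 + e(theta) and the denominator of rho h is 1.  The two directions
    differ only by exchanging z3 and z4. *)

(** * Coordinates *)

Section Coordinates.
Context {R : realType}.

Lemma dot4_vec4B (a b c d a' b' c' d' k l m n : R) :
  dot4 (vec4 a b c d - vec4 a' b' c' d') (vec4 k l m n) =
  (a - a') * k + (b - b') * l + (c - c') * m + (d - d') * n.
Proof.
by rewrite /dot4 mxE !big_ord_recr big_ord0 /= !mxE /= add0r.
Qed.

Lemma lorentz_gt0 (q : prim R) : physical q -> 0 < lorentz q.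
Proof. by move=> [_ _ v1]; rewrite invr_gt0 sqrtr_gt0; lra. Qed.

Lemma lorentz_sqr (q : prim R) : physical q ->
  lorentz q ^+ 2 =
  1 + (lorentz q * vel1 q) ^+ 2 + (lorentz q * vel2 q) ^+ 2.
Proof.
move=> [_ _ v1]; have w0 : 0 < 1 - vel1 q ^+ 2 - vel2 q ^+ 2 by lra.
have : lorentz q ^+ 2 * (1 - vel1 q ^+ 2 - vel2 q ^+ 2) = 1.
  by rewrite exprVn sqr_sqrtr ?(ltW w0)// mulVf// gt_eqF.
by move=> <-; ring.
Qed.

Lemma prim_of_cons_spec (e : R -> R) (U : 'cV[R]_4) : synge_eos e ->
  state_space e U ->
  physical (prim_of_cons e U) /\ cons_of_prim e (prim_of_cons e U) = U.
Proof. by move=> he [q hq <-]; rewrite prim_of_consK. Qed.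

End Coordinates.

(** * The first entropy variable *)

Section EnergyPotential.
Context {R : realType} (e A : R -> R).

(** The part of W1 that depends on the equation of state, and an
    antiderivative of e(1/z): see [entropy_varE] and
    [is_derive_energy_potential]. *)
Definition energy_potential (z : R) : R := z * e z^-1 - A z^-1.

Lemma entropy_varE (U : 'cV[R]_4) : physical (prim_of_cons e U) ->
  entropy_var e A U =
  vec4 (1 + z2 e U + energy_potential (z2 e U) + ln (z1 e U))
       (z2 e U * z3 e U) (z2 e U * z4 e U) (- (z2 e U * gam e U)).
Proof.
rewrite /entropy_var /z1 /z2 /z3 /z4 /gam; set q := prim_of_cons e U.
move=> [r0 p0 _]; have rn := lt0r_neq0 r0; have pn := lt0r_neq0 p0.
have tE : (rho q / pres q)^-1 = theta q by rewrite invf_div.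
apply/matrixP => i j; rewrite !mxE.
case: i => -[|[|[|[|//]]]] /= _; rewrite /energy_potential ?tE.
- by rewrite /enthalpy /entropyS {1 3 4}/theta; field; rewrite rn pn.
- by rewrite -tE invrK.
- by rewrite -tE invrK.
- by rewrite -tE invrK mulrN.
Qed.

Hypothesis he : synge_eos e.
Hypothesis hA : entropy_antiderivative e A.

(** By the chain rule the derivative is
    e(1/z) - e'(1/z)/z + A'(1/z)/z^2, and A'(1/z) = z e'(1/z). *)
Lemma is_derive_energy_potential (z : R) : 0 < z ->
  is_derive z (1 : R) energy_potential (e z^-1).
Proof.
move=> z0; have zn := lt0r_neq0 z0.
have t0 : 0 < z^-1 by rewrite invr_gt0.
have dI : is_derive z (1 : R) (fun x : R => x^-1) (- z ^- 2 *: 1).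
  exact: (@is_deriveV _ id).
have de : is_derive z^-1 (1 : R) e (derive1 e z^-1).
  by have [? _ _ _] := he t0; rewrite derive1E; apply/derivableP.
have dA := hA t0.
have -> : energy_potential =
    id * (e \o (fun x : R => x^-1)) - (A \o (fun x : R => x^-1)).
  by apply/funext => x; rewrite /energy_potential !fctE.
by apply: is_derive_eq; rewrite /= /GRing.scale/=; field.
Qed.

Lemma segment_gt0 (a b s : R) : 0 < a -> 0 < b -> s \in `[0, 1] ->
  0 < a + s * (b - a).
Proof.
move=> a0 b0; rewrite in_itv/= => /andP[s0 s1].
have [->|sn] := eqVneq s 1; first by lra.
have s1' : 0 < 1 - s by rewrite subr_gt0 lt_neqAle sn.
have := mulr_gt0 s1' a0; have := mulr_ge0 s0 (ltW b0); lra.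
Qed.

(** The fundamental theorem of calculus along the segment from [a] to [b],
    parametrized by [0, 1], in either order of [a] and [b]. *)
Lemma energy_potential_jump (a b : R) : 0 < a -> 0 < b -> b - a != 0 ->
  (energy_potential b - energy_potential a) / (b - a) =
  \int[lebesgue_measure]_(s in `[0, 1]) e (1 / (a + s * (b - a))).
Proof.
move=> a0 b0 ab.
pose l (s : R) := a + s * (b - a).
pose G (s : R) := energy_potential (l s) / (b - a).
have dl (s : R) : is_derive s (1 : R) l (b - a).
  have -> : l = cst a + id * cst (b - a) by apply/funext.
  by apply: is_derive_eq; rewrite /= /GRing.scale/=; ring.
have dG (s : R) : s \in `[0, 1] -> is_derive s (1 : R) G (e (1 / l s)).
  move=> s01; have ls0 := segment_gt0 a0 b0 s01.
  have dP := is_derive_energy_potential ls0.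
  have -> : G = (energy_potential \o l) * cst (b - a)^-1 by apply/funext.
  apply: is_derive_eq; rewrite /= /GRing.scale/= div1r.
  by rewrite mulr0 add0r mulrCA mulVf// mulr1.
have sub01 (s : R) : s \in `]0, 1[ -> s \in `[0, 1].
  by apply: subset_itv_oo_cc.
have cG (s : R) : s \in `[0, 1] -> {for s, continuous G}.
  move=> /dG[dGs _]; apply: differentiable_continuous.
  by apply/derivable1_diffP.
rewrite /Rintegral (@continuous_FTC2 _ _ G)//=.
- have -> : G 1 = energy_potential b / (b - a).
    by rewrite /G /l mul1r addrC subrK.
  by rewrite /G /l mul0r addr0 mulrBl.
- apply: derivable_within_continuous => s s01.
  have ls0 := segment_gt0 a0 b0 s01.
  have [de _ _ _] := he (divr_gt0 ltr01 ls0).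
  have de' := derivableP de.
  have dI : is_derive s (1 : R) (fun x => (l x)^-1) (- (l s) ^- 2 *: (b - a)).
    by apply: is_deriveV; rewrite // gt_eqF.
  have -> : (fun x => e (1 / (a + x * (b - a)))) = e \o (fun x => (l x)^-1).
    by apply/funext => x; rewrite /= div1r.
  rewrite div1r in de'.
  by have [] := @is_derive1_comp _ e (fun x => (l x)^-1) _ _ _ de' dI.
- split; first by move=> s /sub01 /dG[].
  + by apply: cvg_at_right_filter; apply: cG; rewrite in_itv/= lexx ler01.
  + by apply: cvg_at_left_filter; apply: cG; rewrite in_itv/= lexx ler01.
- by move=> s /sub01 /dG[_ <-]; rewrite derive1E.
Qed.

End EnergyPotential.

(** * Averages and jumps *)

Section Averages.
Context {R : realType}.

Lemma avgxx (a : R) : avg a a = a.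
Proof. by rewrite /avg; field. Qed.

Lemma log_mean_jump (a b : R) : 0 < a -> 0 < b ->
  log_mean a b * jump (ln a) (ln b) = jump a b.
Proof.
move=> a0 b0; rewrite /log_mean /jump; case: eqVneq => [->|ab].
  by rewrite !subrr mulr0.
by rewrite divfK// subr_eq0; apply: contra ab => /eqP /ln_inj ->//.
Qed.

(** The vectors (gamma, z3, z4) lie on the unit hyperboloid, so the Minkowski
    product of two of them exceeds 0 by Cauchy-Schwarz, and the form at their
    mean is a positive combination of 1, 1 and that product. *)
Lemma avg_lorentz_form_gt0 (g g' x x' y y' : R) :
  0 < g -> 0 < g' -> g ^+ 2 = 1 + x ^+ 2 + y ^+ 2 ->
  g' ^+ 2 = 1 + x' ^+ 2 + y' ^+ 2 ->
  0 < avg g g' ^+ 2 - avg x x' ^+ 2 - avg y y' ^+ 2.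
Proof.
move=> g0 g0' E E'.
have gg : 0 < g * g' by rewrite mulr_gt0.
have CS : (x * x' + y * y') ^+ 2 < (g * g') ^+ 2.
  rewrite -subr_gt0 exprMn E E'.
  have -> : (1 + x ^+ 2 + y ^+ 2) * (1 + x' ^+ 2 + y' ^+ 2) -
      (x * x' + y * y') ^+ 2 =
      1 + (x ^+ 2 + y ^+ 2 + x' ^+ 2 + y' ^+ 2 + (x * y' - y * x') ^+ 2).
    by ring.
  by rewrite ltr_pwDl// !addr_ge0// sqr_ge0.
have lt : x * x' + y * y' < g * g'.
  rewrite (le_lt_trans (ler_norm _))//.
  by rewrite -(@ltr_pXn2r _ 2) ?nnegrE ?(ltW gg)// real_normK ?num_real.
have -> : avg g g' ^+ 2 - avg x x' ^+ 2 - avg y y' ^+ 2 =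
    (g ^+ 2 - x ^+ 2 - y ^+ 2 + (g' ^+ 2 - x' ^+ 2 - y' ^+ 2)
     + 2 * (g * g' - (x * x' + y * y'))) / 4 by rewrite /avg; field.
by rewrite E E'; lra.
Qed.

(** The entropy condition once the equation of state has been absorbed in the
    relation between [w], [dl] and [E].  Here [r], [b] stand for z1, z2, the pair
    [x], [y] for z3, z4 with [x] in the direction of the flux, [m] for the
    logarithmic mean of z1, [dl] for [[ln z1]] and [w] for [[W1]].  The value
    of [H] is the one that cancels every multiple of [[z2]]. *)
Lemma ec_identity (r r' b b' x x' y y' g g' m E dl w : R) :
  0 < g -> 0 < g' -> 0 < b -> 0 < b' ->
  g ^+ 2 = 1 + x ^+ 2 + y ^+ 2 -> g' ^+ 2 = 1 + x' ^+ 2 + y' ^+ 2 ->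
  m * dl = jump r r' -> w = dl + E * jump b b' ->
  let P := avg r r' / avg b b' in
  let H := (P + m * E) / (avg g g' ^+ 2 - avg x x' ^+ 2 - avg y y' ^+ 2) in
  w * (m * avg x x')
  + (b' * x' - b * x) * (H * avg x x' ^+ 2 + P)
  + (b' * y' - b * y) * (H * avg x x' * avg y y')
  + (- (b' * g') - - (b * g)) * (H * avg g g' * avg x x')
  = r' * x' - r * x.
Proof.
move=> g0 g0' b0 b0' Eg Eg' Em -> P H.
have Q0 := avg_lorentz_form_gt0 g0 g0' Eg Eg'.
have HQ : H * (avg g g' ^+ 2 - avg x x' ^+ 2 - avg y y' ^+ 2) = P + m * E.
  by rewrite /H divfK// gt_eqF.
have Pb : P * avg b b' = avg r r'.
  by rewrite /P divfK// gt_eqF// /avg divr_gt0// addr_gt0.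
have prod (c c' : R) :
    b' * c' - b * c = avg b b' * jump c c' + jump b b' * avg c c'.
  by rewrite /avg /jump; field.
have gJ : avg g g' * jump g g' = avg x x' * jump x x' + avg y y' * jump y y'.
  have sqJ (c c' : R) : avg c c' * jump c c' = (c' ^+ 2 - c ^+ 2) / 2.
    by rewrite /avg /jump; field.
  by rewrite !sqJ Eg Eg'; field.
have -> : r' * x' - r * x = avg r r' * jump x x' + jump r r' * avg x x'.
  by rewrite /avg /jump; field.
have -> : - (b' * g') - - (b * g) =
    - (avg b b' * jump g g' + jump b b' * avg g g') by rewrite -prod; ring.
rewrite !prod -Pb -Em.
clearbody H P.
(* The two sides differ by multiples of the relations HQ and gJ. *)
transitivity (P * avg b b' * jump x x' + m * dl * avg x x' +
  jump b b' * avg x x' *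
    (P + m * E - H * (avg g g' ^+ 2 - avg x x' ^+ 2 - avg y y' ^+ 2)) +
  avg b b' * H * avg x x' *
    (avg x x' * jump x x' + avg y y' * jump y y' - avg g g' * jump g g')).
  by ring.
by rewrite HQ gJ !subrr !mulr0 !addr0.
Qed.

End Averages.

(** * Entropy conservation *)

Section EntropyConservation.
Context {R : realType} (e A : R -> R).
Hypothesis he : synge_eos e.
Hypothesis hA : entropy_antiderivative e A.

Lemma z2_gt0 (U : 'cV[R]_4) : state_space e U -> 0 < z2 e U.
Proof. by move=> /(prim_of_cons_spec he)[[? ? _] _]; rewrite divr_gt0. Qed.

Lemma z1_gt0 (U : 'cV[R]_4) : state_space e U -> 0 < z1 e U.
Proof. by move=> /(prim_of_cons_spec he)[[]]. Qed.

Lemma gam_gt0 (U : 'cV[R]_4) : state_space e U -> 0 < gam e U.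
Proof. by move=> /(prim_of_cons_spec he)[pU _]; apply: lorentz_gt0. Qed.

Lemma gam_sqr (U : 'cV[R]_4) : state_space e U ->
  gam e U ^+ 2 = 1 + z3 e U ^+ 2 + z4 e U ^+ 2.
Proof. by move=> /(prim_of_cons_spec he)[pU _]; apply: lorentz_sqr. Qed.

Lemma jump_entropy_var1 (UL UR : 'cV[R]_4) :
  state_space e UL -> state_space e UR ->
  jump (entropy_var e A UL 0 0) (entropy_var e A UR 0 0) =
  jump (ln (z1 e UL)) (ln (z1 e UR)) + jump (z2 e UL) (z2 e UR) +
  jump (energy_potential e A (z2 e UL)) (energy_potential e A (z2 e UR)).
Proof.
move=> /(prim_of_cons_spec he)[pL _] /(prim_of_cons_spec he)[pR _].
by rewrite !entropy_varE// !mxE /jump /=; ring.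
Qed.

Lemma calE_quotientE (UL UR : 'cV[R]_4) :
  state_space e UL -> state_space e UR -> jump (z2 e UL) (z2 e UR) != 0 ->
  calE_quotient e A UL UR = calE_integral e UL UR.
Proof.
move=> sL sR d0; rewrite /calE_quotient /calE_integral.
rewrite jump_entropy_var1//.
rewrite -(energy_potential_jump he hA (z2_gt0 sL) (z2_gt0 sR) d0).
by move: d0; rewrite /jump => d0; field.
Qed.

(** For distinct z2 this is the definition of the quotient; for equal z2 the
    first entropy variable differs only in ln z1, and [[z2]] = 0. *)
Lemma calE_jump (UL UR : 'cV[R]_4) :
  state_space e UL -> state_space e UR ->
  jump (entropy_var e A UL 0 0) (entropy_var e A UR 0 0) =
  jump (ln (z1 e UL)) (ln (z1 e UR)) +
  calE e A UL UR * jump (z2 e UL) (z2 e UR).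
Proof.
move=> sL sR; rewrite /calE; case: eqVneq => [d0|d0].
  rewrite jump_entropy_var1// d0; move/eqP: d0.
  by rewrite /jump subr_eq0 => /eqP ->; rewrite subrr mulr0 !addr0.
by rewrite /calE_quotient divfK// addrC subrK.
Qed.

(** The integrand is constant at equal states. *)
Lemma calE_diag (U : 'cV[R]_4) : state_space e U ->
  calE e A U U = 1 + e (theta (prim_of_cons e U)).
Proof.
move=> sU; rewrite /calE /jump subrr eqxx /calE_integral subrr.
under eq_Rintegral do rewrite mulr0 addr0.
rewrite Rintegral_cst//= lebesgue_measure_itv/= lte_fin ltr01.
by rewrite -EFinB/= subr0 mulr1 div1r /z2 invf_div.
Qed.

(** At equal states the mean flux carries the true rho h, since the form
    gamma^2 - z3^2 - z4^2 equals 1. *)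
Lemma rhoh_hat_diag (U : 'cV[R]_4) : state_space e U ->
  let q := prim_of_cons e U in
  rhoh_hat e A U U = rho q * enthalpy e (theta q).
Proof.
move=> sU q; have [pU _] := prim_of_cons_spec he sU.
have [r0 p0 _] := pU; have rn := lt0r_neq0 r0; have pn := lt0r_neq0 p0.
rewrite /rhoh_hat !avgxx calE_diag// /log_mean eqxx /gam /z1 /z2 /z3 /z4 -/q.
rewrite (lorentz_sqr pU) -/q.
have -> (c d : R) : 1 + c + d - c - d = 1 by ring.
rewrite divr1 /enthalpy; move: (e _) => c; rewrite /theta.
by rewrite -/q in rn pn; field; rewrite rn pn.
Qed.

Lemma cons_coordE (U : 'cV[R]_4) : state_space e U ->
  let q := prim_of_cons e U in
  let H := rho q * enthalpy e (theta q) * lorentz q ^+ 2 in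
  [/\ U 0 0 = rho q * lorentz q, U 1 0 = H * vel1 q &
      U 2%:R 0 = H * vel2 q].
Proof.
move=> sU q H; have [_ /matrixP EU] := prim_of_cons_spec he sU.
by split; rewrite -EU mxE.
Qed.

Lemma flux1_EC_consistent (U : 'cV[R]_4) : state_space e U ->
  flux1_EC e A U U = flux1 e U.
Proof.
move=> sU; have [[r0 p0 _] _] := prim_of_cons_spec he sU.
have rn := lt0r_neq0 r0; have pn := lt0r_neq0 p0.
rewrite /flux1_EC /flux1 rhoh_hat_diag// !avgxx /log_mean eqxx.
have [-> -> ->] := cons_coordE sU; rewrite /z1 /z2 /z3 /z4 /gam.
by congr vec4; field; rewrite ?rn ?pn.
Qed.

Lemma flux2_EC_consistent (U : 'cV[R]_4) : state_space e U ->
  flux2_EC e A U U = flux2 e U.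
Proof.
move=> sU; have [[r0 p0 _] _] := prim_of_cons_spec he sU.
have rn := lt0r_neq0 r0; have pn := lt0r_neq0 p0.
rewrite /flux2_EC /flux2 rhoh_hat_diag// !avgxx /log_mean eqxx.
have [-> -> ->] := cons_coordE sU; rewrite /z1 /z2 /z3 /z4 /gam.
by congr vec4; field; rewrite ?rn ?pn.
Qed.

Lemma flux1_EC_entropy (UL UR : 'cV[R]_4) :
  state_space e UL -> state_space e UR ->
  dot4 (entropy_var e A UR - entropy_var e A UL) (flux1_EC e A UL UR) =
  potential1 e UR - potential1 e UL.
Proof.
move=> sL sR; have JW := calE_jump sL sR.
have Em := log_mean_jump (z1_gt0 sL) (z1_gt0 sR).
have := ec_identity (gam_gt0 sL) (gam_gt0 sR) (z2_gt0 sL) (z2_gt0 sR)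
  (gam_sqr sL) (gam_sqr sR) Em JW.
have potE (U : 'cV[R]_4) : potential1 e U = z1 e U * z3 e U.
  by rewrite /potential1 -mulrA.
rewrite /= -/(rhoh_hat e A UL UR) !potE => <-.
have [pL _] := prim_of_cons_spec he sL; have [pR _] := prim_of_cons_spec he sR.
by rewrite /flux1_EC !entropy_varE// dot4_vec4B !mxE.
Qed.

Lemma flux2_EC_entropy (UL UR : 'cV[R]_4) :
  state_space e UL -> state_space e UR ->
  dot4 (entropy_var e A UR - entropy_var e A UL) (flux2_EC e A UL UR) =
  potential2 e UR - potential2 e UL.
Proof.
move=> sL sR; have JW := calE_jump sL sR.
have Em := log_mean_jump (z1_gt0 sL) (z1_gt0 sR).
(* Exchanging z3 and z4 reduces the second direction to the first. *)
have := gam_sqr sL; rewrite addrAC => EL.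
have := gam_sqr sR; rewrite addrAC => ER.
have := ec_identity (gam_gt0 sL) (gam_gt0 sR) (z2_gt0 sL) (z2_gt0 sR)
  EL ER Em JW.
have potE (U : 'cV[R]_4) : potential2 e U = z1 e U * z4 e U.
  by rewrite /potential2 -mulrA.
rewrite /= [avg (gam e UL) (gam e UR) ^+ 2 - _ - _]addrAC.
rewrite -/(rhoh_hat e A UL UR) !potE => <-.
have [pL _] := prim_of_cons_spec he sL; have [pR _] := prim_of_cons_spec he sR.
rewrite /flux2_EC !entropy_varE// dot4_vec4B !mxE /jump /=; ring.
Qed.

End EntropyConservation.

Theorem theorem8 (R : realType) (e A : R -> R) :
  synge_eos e -> entropy_antiderivative e A ->
  [/\ forall UL UR : 'cV[R]_4, state_space e UL -> state_space e UR ->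
        jump (z2 e UL) (z2 e UR) != 0 ->
        calE_quotient e A UL UR = calE_integral e UL UR,
      entropy_conservative e A (flux1 e) (potential1 e) (flux1_EC e A) &
      entropy_conservative e A (flux2 e) (potential2 e) (flux2_EC e A)].
Proof.
move=> he hA; split.
- by move=> UL UR; apply: calE_quotientE.
- split; first by move=> U; apply: flux1_EC_consistent.
  by move=> UL UR; apply: flux1_EC_entropy.
- split; first by move=> U; apply: flux2_EC_consistent.
  by move=> UL UR; apply: flux2_EC_entropy.
Qed.
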